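(* Let $\Omega\subset\mathbb{R}^n$ be an open set, let $F:\partial\Omega\to\mathbb{R}$ be Lipschitz continuous, and let $u$ be any Lipschitz extension of $F$ to $\Omega$, i.e., a Lipschitz function $u:\Omega\to\mathbb{R}$ such that $u=F$ on $\partial\Omega$ and whose least Lipschitz constant satisfies $L_u(\Omega)=L_F(\partial\Omega)$. Then, for every $\lambda\ge L_F(\partial\Omega)$, $$\begin{cases}\min\{|\nabla u(x)|-\lambda,\,-\Delta_\infty u(x)\}\le0 & \text{in }\Omega,\\ u(x)=F(x) & \text{on }\partial\Omega,\end{cases}$$ and $$\begin{cases}\max\{\lambda-|\nabla u(x)|,\,-\Delta_\infty u(x)\}\ge0 & \text{in }\Omega,\\ u(x)=F(x) & \text{on }\partial\Omega,\end{cases}$$ in the viscosity sense; that is, $u$ is a viscosity subsolution of the first problem and a viscosity supersolution of the second.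
   Context: For $K\subset\mathbb{R}^n$ and $g:K\to\mathbb{R}$ Lipschitz, $L_g(K)$ denotes the smallest constant $\lambda\ge0$ such that $|g(x)-g(y)|\le\lambda|x-y|$ for all $x,y\in K$; $|\cdot|$ is the Euclidean norm. The values of the Lipschitz function $u:\Omega\to\mathbb{R}$ on $\partial\Omega$ are those of its unique continuous extension to $\overline\Omega$. The infinity Laplacian of a $C^2$ function $\phi$ is $\Delta_\infty\phi(x)=\langle D^2\phi(x)\nabla\phi(x),\nabla\phi(x)\rangle$. Viscosity inequalities: $\min\{|\nabla u|-\lambda,-\Delta_\infty u\}\le0$ in $\Omega$ in the viscosity sense means that whenever $\hat x\in\Omega$ and $\phi\in C^2(\Omega)$ touches $u$ at $\hat x$ from above in a neighborhood of $\hat x$ (i.e. $\phi(\hat x)=u(\hat x)$ and $\phi\ge u$ near $\hat x$), one has $\min\{|\nabla\phi(\hat x)|-\lambda,-\Delta_\infty\phi(\hat x)\}\le0$. Likewise, $\max\{\lambda-|\nabla u|,-\Delta_\infty u\}\ge0$ in $\Omega$ in the viscosity sense means that whenever $\hat x\in\Omega$ and $\phi\in C^2(\Omega)$ touches $u$ at $\hat x$ from below in a neighborhood of $\hat x$ (i.e. $\phi(\hat x)=u(\hat x)$ and $\phi\le u$ near $\hat x$), one has $\max\{\lambda-|\nabla\phi(\hat x)|,-\Delta_\infty\phi(\hat x)\}\ge0$. The boundary condition $u=F$ on $\partial\Omega$ is understood pointwise. *)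

(* Defs.v *)
From HB Require Import structures.
From mathcomp Require Import all_boot all_order all_algebra.
From mathcomp Require Import all_classical all_reals all_analysis.

Set Implicit Arguments.
Unset Strict Implicit.
Unset Printing Implicit Defensive.

Import Order.TTheory GRing.Theory Num.Theory.
Import numFieldNormedType.Exports.

Local Open Scope classical_set_scope.
Local Open Scope ring_scope.

(* R^n is 'rV[R]_n. The library norm `|x| on it is the sup norm; it induces the
   usual topology, but the metric notions below need the Euclidean norm. *)
Section euclidean.
Context {R : realType} {n : nat}.
Implicit Types (x y : 'rV[R]_n) (K : set 'rV[R]_n) (g : 'rV[R]_n -> R).

Definition dotp x y : R := \sum_(i < n) x 0 i * y 0 i.

Definition enorm x : R := Num.sqrt (dotp x x).

Definition boundary K : set 'rV[R]_n := closure K `\` interior K.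

(* A function K -> R is represented by a total function, of which only the
   values on K matter. *)
Definition lipschitz_consts K g : set R :=
  [set l | 0 <= l /\
     forall x y, K x -> K y -> `|g x - g y| <= l * enorm (x - y)].

Definition elipschitz_on K g : Prop := lipschitz_consts K g !=set0.

(* The infimum is a minimum for g Lipschitz on K: see lip_const_least. *)
Definition lip_const K g : R := inf (lipschitz_consts K g).

Lemma lip_const_least K g : elipschitz_on K g ->
  lipschitz_consts K g (lip_const K g) /\
  lbound (lipschitz_consts K g) (lip_const K g).
Proof.
move=> gK.
have lb0 : lbound (lipschitz_consts K g) 0 by move=> l [].
split; last by apply: ge_inf; exists 0.
split=> [|x y Kx Ky]; first exact: lb_le_inf.
have := sqrtr_ge0 (dotp (x - y) (x - y)); rewrite -/(enorm (x - y)) le_eqVlt.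
case/orP=> [/eqP e0|e_gt0].
  by have [l [_ /(_ x y Kx Ky)]] := gK; rewrite -e0 !mulr0.
rewrite -ler_pdivrMr//; apply: lb_le_inf => // l [_ /(_ x y Kx Ky)].
by rewrite ler_pdivrMr.
Qed.

(* The continuous extension of u from Om to its closure is F on the boundary. *)
Definition has_boundary_values (Om : set 'rV[R]_n) (u F : 'rV[R]_n -> R) :
    Prop :=
  exists ubar : 'rV[R]_n -> R,
    [/\ {within closure Om, continuous ubar},
        forall x, Om x -> ubar x = u x &
        forall x, boundary Om x -> ubar x = F x].

End euclidean.

Section smooth.
Context {R : realType} {n : nat}.
Implicit Types (phi : 'rV[R]_n -> R) (x : 'rV[R]_n) (i j : 'I_n).

Definition partial i phi : 'rV[R]_n -> R := 'D_(delta_mx 0 i) phi.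

Definition has_partial i phi x : Prop := derivable phi x (delta_mx 0 i).

Definition C2_on (Om : set 'rV[R]_n) phi : Prop :=
  forall x, Om x ->
    [/\ {for x, continuous phi},
        forall i, has_partial i phi x /\ {for x, continuous (partial i phi)} &
        forall i j, has_partial i (partial j phi) x /\
                    {for x, continuous (partial i (partial j phi))}].

Definition gradient phi x : 'rV[R]_n := \row_i partial i phi x.

Definition hessian phi x : 'M[R]_n := \matrix_(i, j) partial i (partial j phi) x.

Definition inf_laplacian phi x : R :=
  dotp (hessian phi x *m (gradient phi x)^T)^T (gradient phi x).

End smooth.

Section viscosity.
Context {R : realType} {n : nat}.
Implicit Types (Om : set 'rV[R]_n) (u F : 'rV[R]_n -> R) (lambda : R).

Definition touches_from_above u x (phi : 'rV[R]_n -> R) : Prop :=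
  phi x = u x /\ \forall y \near x, u y <= phi y.

Definition touches_from_below u x (phi : 'rV[R]_n -> R) : Prop :=
  phi x = u x /\ \forall y \near x, phi y <= u y.

Definition visc_min_le0 Om lambda u : Prop :=
  forall x phi, Om x -> C2_on Om phi -> touches_from_above u x phi ->
    Num.min (enorm (gradient phi x) - lambda) (- inf_laplacian phi x) <= 0.

Definition visc_max_ge0 Om lambda u : Prop :=
  forall x phi, Om x -> C2_on Om phi -> touches_from_below u x phi ->
    0 <= Num.max (lambda - enorm (gradient phi x)) (- inf_laplacian phi x).

Definition visc_subsolution_min Om lambda F u : Prop :=
  visc_min_le0 Om lambda u /\ has_boundary_values Om u F.

Definition visc_supersolution_max Om lambda F u : Prop :=
  visc_max_ge0 Om lambda u /\ has_boundary_values Om u F.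

End viscosity.

(* Main.v *)
Require Import Defs.
From HB Require Import structures.
From mathcomp Require Import all_boot all_order all_algebra.
From mathcomp Require Import all_classical all_reals all_analysis.
From mathcomp Require Import lra.
Import Order.TTheory GRing.Theory Num.Theory.
Import numFieldNormedType.Exports.
Local Open Scope classical_set_scope.
Local Open Scope ring_scope.

(** Let [L] be the Lipschitz constant of [u]. If [phi] touches [u] from below at
    [x], then [phi y - phi x <= u y - u x <= L * enorm (y - x)] near [x], so
    [phi] cannot grow faster than [L] in any direction; moving along its own
    gradient gives [enorm (gradient phi x) <= L <= lambda], and the entry
    [lambda - enorm (gradient phi x)] of the maximum is nonnegative. If [phi]
    touches from above, the same bound holds for [- phi], whose gradient has the
    same length, and the entry [enorm (gradient phi x) - lambda] of the minimum
    is nonpositive.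

    Moving along the gradient uses the first-order expansion of [phi] at [x],
    whereas being C2 is a statement on iterated partial derivatives along the
    coordinate axes. The two are related by the classical theorem that a
    function with continuous partial derivatives is differentiable
    ([has_gradient_gradient]); it rests on the mean value theorem on segments
    parallel to the axes ([mean_value_line]). The bound on the gradient is
    [enorm_gradient_le]. *)

Lemma is_derive_line (R : realType) (V : normedModType R) (f : V -> R)
    (z d : V) (s : R) : derivable f (z + s *: d) d ->
  is_derive s 1 (fun r : R => f (z + r *: d)) ('D_d f (z + s *: d)).
Proof.
move=> fd.
have E : (fun h : R => h^-1 *: (((fun r : R => f (z + r *: d)) \o shift s)
      (h *: 1) - f (z + s *: d))) =
    (fun h : R => h^-1 *: ((f \o shift (z + s *: d)) (h *: d)
      - f (z + s *: d))).
  apply/funext => h /=; congr (_ *: (f _ - _)).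
  by rewrite scalerDl [h *: 1]mulr1 addrCA.
by split; [rewrite /derivable E | rewrite /derive E].
Qed.

(** The sign of [c] is free, so that the lemma applies to a coordinate step
    [c *: 'e_k] in either direction along the axis. *)
Lemma mean_value_line (R : realType) (V : normedModType R) (f : V -> R)
    (z d : V) (c : R) :
  (forall s : R, `|s| <= `|c| -> derivable f (z + s *: d) d) ->
  exists2 s : R, `|s| <= `|c| & f (z + c *: d) - f z = c * 'D_d f (z + s *: d).
Proof.
move=> fd; pose g r : R := f (z + r *: d).
have dg (s : R) : `|s| <= `|c| -> is_derive s 1 g ('D_d f (z + s *: d)).
  by move=> sc; apply/is_derive_line/fd.
have mvt (a b : R) : a <= b -> (forall s : R, s \in `[a, b] -> `|s| <= `|c|) ->
    exists2 s : R, `|s| <= `|c| & g b - g a = 'D_d f (z + s *: d) * (b - a).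
  move=> ab abc.
  have [||s sab e] := @MVT_segment _ g (fun s => 'D_d f (z + s *: d)) _ _ ab.
  - by move=> s sab; apply/dg/abc/subset_itv_oo_cc.
  - apply: derivable_within_continuous => s sab.
    by have [] := dg _ (abc _ sab).
  - by exists s => //; apply: abc.
have g0 : g 0 = f z by rewrite /g scale0r addr0.
have [c0|c0] := leP 0 c.
  have [||s sc e] := mvt 0 c => //.
    by move=> s; rewrite in_itv/= => /andP[s0 sc]; rewrite !ger0_norm.
  by exists s => //; rewrite -/(g c) -g0 e subr0 mulrC.
have [||s sc e] := mvt c 0; first exact: ltW.
  by move=> s; rewrite in_itv/= => /andP[? ?]; rewrite !ler0_norm ?lerN2// ltW.
exists s => //; by rewrite -/(g c) -g0 -opprB e sub0r mulrN opprK mulrC.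
Qed.

Section has_gradient.
Context {R : realType} {n : nat}.
Implicit Types (f : 'rV[R]_n -> R) (x y p v : 'rV[R]_n).

(** Fréchet differentiability with differential [dotp p]. The remainder is
    measured in the sup norm, for which the neighborhoods of [x] are boxes; all
    norms being equivalent, this is the same notion as for [enorm]. *)
Definition has_gradient f x p := forall e : R, 0 < e ->
  \forall y \near x, `|f y - f x - dotp p (y - x)| <= e * `|y - x|.

Lemma has_gradientN f x p : has_gradient f x p -> has_gradient (- f) x (- p).
Proof.
move=> fp e /fp; apply: filterS => y.
have -> : dotp (- p) (y - x) = - dotp p (y - x).
  by rewrite /dotp -sumrN; apply: eq_bigr => i _; rewrite mxE mulNr.
have -> : (- f) y - (- f) x - - dotp p (y - x) = - (f y - f x - dotp p (y - x)).
  by rewrite !opprB !fctE opprK; lra.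
by rewrite normrN.
Qed.

Lemma enormN v : enorm (- v) = enorm v.
Proof.
by congr Num.sqrt; apply: eq_bigr => i _; rewrite mxE mulrNN.
Qed.

Lemma dotpZr p v (t : R) : dotp p (t *: v) = t * dotp p v.
Proof.
by rewrite /dotp mulr_sumr; apply: eq_bigr => i _; rewrite mxE mulrCA.
Qed.

Lemma dotpp v : dotp v v = enorm v ^+ 2.
Proof.
by rewrite sqr_sqrtr// sumr_ge0 // => i _; rewrite -expr2 sqr_ge0.
Qed.

Lemma enormZ (t : R) v : 0 <= t -> enorm (t *: v) = t * enorm v.
Proof.
move=> t0; rewrite /enorm dotpZr.
have -> : dotp (t *: v) v = t * dotp v v.
  by rewrite /dotp mulr_sumr; apply: eq_bigr => i _; rewrite mxE mulrA.
by rewrite mulrA sqrtrM ?mulr_ge0// -expr2 sqrtr_sqr ger0_norm.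
Qed.

(** Along [y = x + t *: p] with [t > 0] small, [f] grows by
    [t * enorm p ^+ 2] up to [o(t)], and by at most [L * t * enorm p]: hence
    [enorm p ^+ 2 <= L * enorm p]. *)
Lemma enorm_gradient_le f x p (L : R) : has_gradient f x p -> 0 <= L ->
  (\forall y \near x, f y - f x <= L * enorm (y - x)) -> enorm p <= L.
Proof.
move=> fp L0 fL.
have pL : enorm p ^+ 2 <= L * enorm p.
  apply/ler_addgt0Pr => e e0.
  (* The expansion is used with the relative error [e / (1 + `|p|)], whose
     contribution at [x + t *: p] is then at most [t * e]. *)
  have q0 : 0 < 1 + `|p| by rewrite ltr_wpDr.
  have [/= t [[t0]]] : exists t : R,
      (0 < t /\ f (x + t *: p) - f x <= L * enorm (x + t *: p - x)) /\
      `|f (x + t *: p) - f x - dotp p (x + t *: p - x)|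
        <= e / (1 + `|p|) * `|x + t *: p - x|.
    have xt : x + t *: p @[t --> (0 : R)^'+] --> x.
      suff : x + t *: p @[t --> (0 : R)^'+] --> x + (0 : R) *: p.
        by rewrite scale0r addr0.
      apply: cvg_at_right_filter; apply: cvgD; first exact: cvg_cst.
      exact: scalel_continuous.
    near (0 : R)^'+ => t; exists t; split; first split.
    - by [].
    - by near: t; exact: (xt _ fL).
    - by near: t; apply: (xt _ (fp (e / (1 + `|p|)) _)); exact: divr_gt0.
  rewrite [x + _]addrC addrK enormZ ?(ltW t0)//.
  rewrite dotpZr dotpp normrZ (gtr0_norm t0).
  move=> le1 /ler_normlP[le2 _].
  have ep : e / (1 + `|p|) * `|p| <= e.
    by rewrite mulrAC ler_pdivrMr// ler_pM2l// lerDr.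
  rewrite -(ler_pM2l t0).
  have : t * (e / (1 + `|p|) * `|p|) <= t * e by rewrite ler_pM2l.
  rewrite mulrCA in le1; rewrite mulrCA in le2; lra.
have := sqrtr_ge0 (dotp p p); rewrite -/(enorm p) le_eqVlt => /predU1P[<-//|p0].
by move: pL; rewrite expr2 ler_pM2r.
Unshelve. all: by end_near.
Qed.

(** Go from [x] to [y] by changing one coordinate at a time. By the mean value
    theorem, the [k]-th step changes [f] by [(y - x) 0 k] times the [k]-th
    partial derivative at an intermediate point, which by continuity is close to
    its value at [x]. *)
Lemma has_gradient_gradient f x :
  (\forall y \near x, forall i, has_partial i f y) ->
  (forall i, {for x, continuous (partial i f)}) ->
  has_gradient f x (gradient f x).
Proof.
move=> fd fc e e0.
(* Each of the [n] steps may cost [e / n.+1%:R * `|y - x|]; the successor keeps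
   the denominator positive in dimension 0. *)
have e'0 : 0 < e / n.+1%:R by rewrite divr_gt0.
have /nbhs_ballP[r /= r0 fr] : \forall y \near x,
    (forall i, has_partial i f y) /\
    forall i, `|partial i f y - partial i f x| <= e / n.+1%:R.
  near=> y; split; first by near: y.
  near: y; apply: filter_forall => i.
  have := fc i => /cvgrPdist_le/(_ _ e'0).
  by apply: filterS => y; rewrite distrC.
near=> y; set v := y - x.
have vr i : `|v 0 i| < r.
  have [_ /(_ 0 i)] : ball x r y by near: y; exact: nbhsx_ballx.
  by rewrite /ball/= distrC !mxE.
have vi i : `|v 0 i| <= `|v|.
  by rewrite [leRHS]mx_normrE (le_bigmax _ (fun ij => `|v ij.1 ij.2|) (0, i)).
(* [w k] has the first [k] coordinates of [y] and the other ones of [x]. *)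
pose w (k : nat) : 'rV[R]_n := x + \row_i (if (i < k)%N then v 0 i else 0).
have wS (k : 'I_n) : w k.+1 = w k + v 0 k *: delta_mx 0 k.
  rewrite /w -addrA; congr (_ + _); apply/rowP => i; rewrite !mxE eqxx/= ltnS.
  rewrite -(inj_eq val_inj) /=.
  by case: (ltngtP i k) => [ik|ki|/val_inj->];
    rewrite ?mulr0 ?addr0 ?mulr1 ?add0r.
have w0 : w 0 = x.
  by rewrite /w -[RHS]addr0; congr (_ + _); apply/rowP => i; rewrite !mxE.
have wn : w n = y.
  rewrite /w -[RHS](subrKC x) -/v; congr (_ + _); apply/rowP => i.
  by rewrite mxE ltn_ord.
have step (k : 'I_n) :
    `|f (w k.+1) - f (w k) - partial k f x * v 0 k| <= e / n.+1%:R * `|v|.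
  (* The [k]-th segment stays in the box where the partial derivatives are
     controlled. *)
  have wr (s : R) : `|s| <= `|v 0 k| -> ball x r (w k + s *: delta_mx 0 k).
    move=> sv; split=> // i0 i; rewrite {i0}ord1 /ball/= distrC !mxE eqxx/=.
    rewrite -(addrA (x 0 i)) (addrC (x 0 i)) addrK.
    have [->|ik] := eqVneq i k; first by rewrite ltnn add0r mulr1
      (le_lt_trans sv).
    rewrite mulr0 addr0; case: ifP => _; last by rewrite normr0.
    by have := vr i; rewrite /v !mxE.
  rewrite wS; have [s sv ->] : exists2 s : R, `|s| <= `|v 0 k| &
      f (w k + v 0 k *: delta_mx 0 k) - f (w k)
        = v 0 k * 'D_(delta_mx 0 k) f (w k + s *: delta_mx 0 k).
    by apply: mean_value_line => s /wr/fr[fd' _]; exact: fd'.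
  have [_ /(_ k)] := fr _ (wr _ sv); rewrite /partial => dk.
  by rewrite mulrC -mulrBl normrM ler_pM.
have -> : f y - f x - dotp (gradient f x) v =
    \sum_(k < n) (f (w k.+1) - f (w k) - partial k f x * v 0 k).
  rewrite sumrB -(big_mkord xpredT (fun k => f (w k.+1) - f (w k))).
  rewrite telescope_sumr// wn w0; congr (_ - _).
  by apply: eq_bigr => i _; rewrite mxE.
apply: (le_trans (ler_norm_sum _ _ _)).
apply: (@le_trans _ _ (\sum_(k < n) (e / n.+1%:R * `|v|))).
  by apply: ler_sum => k _; exact: step.
rewrite sumr_const card_ord -mulrnAl ler_wpM2r//.
by rewrite -mulr_natr mulrAC ler_pdivrMr// ler_pM2l// ler_nat.
Unshelve. all: by end_near.
Qed.
End has_gradient.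

Theorem theorem1p3 (R : realType) (n : nat) (Om : set 'rV[R]_n)
    (F u : 'rV[R]_n -> R) :
  open Om ->
  elipschitz_on (boundary Om) F ->
  elipschitz_on Om u ->
  has_boundary_values Om u F ->
  lip_const Om u = lip_const (boundary Om) F ->
  forall lambda : R, lip_const (boundary Om) F <= lambda ->
    visc_subsolution_min Om lambda F u /\ visc_supersolution_max Om lambda F u.
Proof.
move=> oOm _ uL uF <- lambda Llambda.
have [[L0 uLip] _] := lip_const_least uL.
have grad phi x : Om x -> C2_on Om phi -> has_gradient phi x (gradient phi x).
  move=> Omx phiC2; apply: has_gradient_gradient => [|i].
    have : \forall y \near x, Om y by exact: open_nbhs_nbhs.
    by apply: filterS => y /phiC2[_ phi1 _] i; have [] := phi1 i.
  by have [_ /(_ i)[]] := phiC2 x Omx.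
have near_lip x : Om x -> \forall y \near x,
    `|u y - u x| <= lip_const Om u * enorm (y - x).
  move=> Omx; have : \forall y \near x, Om y by exact: open_nbhs_nbhs.
  by apply: filterS => y Omy; exact: uLip.
split; split=> // x phi Omx phiC2 [phix phiu].
- rewrite ge_min subr_le0; apply/orP; left; apply: le_trans Llambda.
  rewrite -enormN; apply: enorm_gradient_le L0 _.
    by apply: has_gradientN; exact: grad.
  near=> y.
  have /ler_normlP[le1 _] : `|u y - u x| <= lip_const Om u * enorm (y - x).
    by near: y; exact: near_lip.
  have : u y <= phi y by near: y.
  by rewrite !fctE phix; lra.
- rewrite le_max subr_ge0; apply/orP; left; apply: le_trans Llambda.
  apply: enorm_gradient_le L0 _; first exact: grad.
  near=> y.
  have /ler_normlP[_ le1] : `|u y - u x| <= lip_const Om u * enorm (y - x).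
    by near: y; exact: near_lip.
  have : phi y <= u y by near: y.
  by rewrite phix; lra.
Unshelve. all: by end_near.
Qed.
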